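(* Let $(X,\mathcal{B},\mu)$ be a probability space, let $T:X\to X$ be a (possibly noninvertible) measure-preserving transformation, and let $f\in L^1(X,\mathcal{B},\mu)$ be real-valued. Let $f^*=\sup_{k\ge 1}\frac1k\sum_{j=0}^{k-1} f\circ T^j$. Let $\lambda:X\to\mathbb{R}$ be a measurable function which is invariant, i.e. $\lambda\circ T=\lambda$ $\mu$-a.e., and such that $\lambda^+\in L^1(X,\mathcal{B},\mu)$. Then $$\int_{\{f^*>\lambda\}}(f-\lambda)\,d\mu\ \ge\ 0.$$
   Context: $T$ measure-preserving means that $T$ is measurable and $\mu(T^{-1}B)=\mu(B)$ for all $B\in\mathcal{B}$. The function $f^*$ takes values in $(-\infty,+\infty]$. Write $\lambda^+=\max(\lambda,0)$ and $\{f^*>\lambda\}=\{x\in X: f^*(x)>\lambda(x)\}$. Only $\lambda^+$, not $\lambda$ itself, is assumed integrable. Since the negative part of $f-\lambda$ is bounded by $|f|+\lambda^+$, which is integrable, the integral in the conclusion is well defined as an element of $(-\infty,+\infty]$, and the value $+\infty$ is allowed. *)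

(* Defs.v *)
From mathcomp Require Import all_boot all_order all_algebra.
From mathcomp Require Import all_classical all_reals all_analysis.
Set Implicit Arguments.
Unset Strict Implicit.
Unset Printing Implicit Defensive.
Import Order.TTheory GRing.Theory Num.Theory.
Import numFieldNormedType.Exports.
Local Open Scope classical_set_scope.
Local Open Scope ring_scope.

(* No invertibility of T is required. *)
Definition measure_preserving d (X : measurableType d) (R : realType)
    (mu : set X -> \bar R) (T : X -> X) : Prop :=
  measurable_fun [set: X] T /\
  forall B : set X, measurable B -> mu (T @^-1` B) = mu B.

Definition ergodic_average (X : Type) (R : realType)
    (T : X -> X) (f : X -> R) (k : nat) (x : X) : R :=
  k%:R^-1 * \sum_(0 <= j < k) f (iter j T x).

(* The supremum is over k >= 1 only, and is taken in the extended reals, so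
   that +oo is a possible value. *)
Definition maximal_function (X : Type) (R : realType)
    (T : X -> X) (f : X -> R) (x : X) : \bar R :=
  ereal_sup [set (ergodic_average T f k x)%:E | k in [set k | (1 <= k)%N]].

(* Main.v *)
Require Import Defs.
From mathcomp Require Import all_boot all_order all_algebra.
From mathcomp Require Import all_classical all_reals all_analysis.
From mathcomp Require Import measurable_realfun lra.
Set Implicit Arguments.
Unset Strict Implicit.
Unset Printing Implicit Defensive.
Import Order.TTheory GRing.Theory Num.Theory.
Import numFieldNormedType.Exports.
Local Open Scope classical_set_scope.
Local Open Scope ring_scope.

(** Garsia's argument.  Put [g = f - lambda], and let [M_n] be the maximum of
    the Birkhoff sums of [g] of length [0, ..., n].  On [{M_n > 0}] one has
    [g >= M_n - M_n \o T], and as [M_n >= 0] vanishes elsewhere, integrating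
    gives a nonnegative result, provided [g] is integrable.  In general [g] is
    only integrable on the invariant sets [{lambda >= - n}].  There the
    inequality reads [int g^- <= int g^+], and monotone convergence applies to
    each side separately. *)

(** * Integrals and null sets under a measure-preserving map *)

Section measure_preserving_integral.
Context {R : realType} {d : measure_display} {X : measurableType d}.
Context {mu : {measure set X -> \bar R}} {T : X -> X}.
Hypothesis hT : measure_preserving mu T.

Lemma ge0_integral_measure_preserving (h : X -> \bar R) :
  measurable_fun [set: X] h -> (forall x, 0 <= h x)%E ->
  (\int[mu]_x h (T x) = \int[mu]_x h x)%E.
Proof.
case: hT => mT eT mh h0.
rewrite -[LHS](ge0_integral_pushforward mT mu measurableT)//.
by apply: eq_measure_integral => A mA _; exact: eT.
Qed.

Lemma integrable_measure_preserving (h : X -> \bar R) :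
  mu.-integrable [set: X] h -> mu.-integrable [set: X] (h \o T).
Proof.
move=> /integrableP[mh hoo]; apply/integrableP; split.
  by apply: measurableT_comp => //; case: hT.
rewrite (@ge0_integral_measure_preserving (fun x => `|h x|)%E)//.
exact: measurableT_comp.
Qed.

(** The preimage under [T] of the null set for exponent [j] is a null set for [j.+1]; countably many
    null sets are then merged. *)
Lemma ae_measure_preserving_iter (P : X -> Prop) :
  {ae mu, forall x, P x} -> {ae mu, forall x, forall j, P (iter j T x)}.
Proof.
case: hT => mT eT aP; apply: ae_foralln; elim=> [//|j [N [mN N0 PN]]].
exists (T @^-1` N); split; first by rewrite -[_ @^-1` _]setTI; exact: mT.
  by rewrite eT.
by move=> x /=; rewrite -iterS iterSr => nP; apply: PN.
Qed.

End measure_preserving_integral.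

Lemma measurable_set_ltr (R : realType) (d : measure_display)
    (X : measurableType d) (g h : X -> R) :
  measurable_fun [set: X] g -> measurable_fun [set: X] h ->
  measurable [set x | g x < h x].
Proof.
move=> mg mh; rewrite -[X in measurable X]setTI.
under eq_set do rewrite -lte_fin.
by apply: measurable_lte => //; exact/measurable_EFinP.
Qed.

(** * Running maxima of Birkhoff sums *)

Section running_maximum.
Context {R : realType} {X : Type}.
Implicit Types (T : X -> X) (g : X -> R).

Fixpoint birkhoff_max T g (n : nat) (x : X) : R :=
  if n is m.+1 then Num.max (g x + birkhoff_max T g m (T x)) 0 else 0.

Lemma birkhoff_max_ge0 T g n x : 0 <= birkhoff_max T g n x.
Proof. by case: n => //= n; rewrite le_max lexx orbT. Qed.

Lemma birkhoff_max_leS T g n x :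
  birkhoff_max T g n x <= birkhoff_max T g n.+1 x.
Proof.
elim: n x => [|n IH] x; first exact: birkhoff_max_ge0.
rewrite -/(birkhoff_max T g n.+1 x) [leRHS]/= [leLHS]/=.
by rewrite ge_max !le_max lexx orbT andbT lerD2l IH.
Qed.

(** Removing the first term of a sum of length [k.+1] at [x] leaves a sum of length [k] at [T x], as
    in the recursion; the empty sum accounts for the value [0] in the maximum. *)
Lemma birkhoff_max_gtP T g n a x :
  a < birkhoff_max T g n x <->
  exists2 k, (k <= n)%N & a < \sum_(0 <= j < k) g (iter j T x).
Proof.
elim: n a x => [|n IH] a x.
  split=> [a0|[k]]; first by exists 0%N => //; rewrite big_geq.
  by rewrite leqn0 => /eqP->; rewrite big_geq.
rewrite /= lt_max; split.
  case/orP => [|a0]; last by exists 0%N => //; rewrite big_geq.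
  rewrite -ltrBlDl => /IH[k kn ak]; exists k.+1 => //.
  rewrite big_nat_recl//= -ltrBlDl (lt_le_trans ak)// le_eqVlt; apply/orP; left.
  by apply/eqP; apply: eq_bigr => i _; rewrite -iterSr.
case=> -[_|k kn]; first by rewrite big_geq// => ->; rewrite orbT.
rewrite big_nat_recl//= -ltrBlDl => ak.
apply/orP; left; rewrite -ltrBlDl; apply/IH; exists k => //.
by under eq_bigr do rewrite -iterSr.
Qed.

End running_maximum.

(** * Garsia's inequality for integrable [g] *)

Section maximal_inequality.
Context {R : realType} {d : measure_display} {X : measurableType d}.
Context {mu : {measure set X -> \bar R}} {T : X -> X}.
Hypothesis hT : measure_preserving mu T.
Variable g : X -> R.
Hypothesis ig : mu.-integrable [set: X] (EFin \o g).

Lemma integrable_birkhoff_max n :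
  mu.-integrable [set: X] (EFin \o birkhoff_max T g n).
Proof.
elim: n => [|n IH]; first exact: integrable0.
(* [M_(n+1)] is the positive part of [g + M_n \o T]. *)
have := integrableD measurableT ig (integrable_measure_preserving hT IH).
move=> /(integrable_funepos measurableT); apply: eq_integrable => // x _.
by rewrite funeposE /= -EFinD EFin_max.
Qed.

Lemma measurable_birkhoff_max n :
  measurable_fun [set: X] (birkhoff_max T g n).
Proof. exact/measurable_EFinP/(measurable_int mu)/integrable_birkhoff_max. Qed.

Lemma measurable_birkhoff_max_gt0 n :
  measurable [set x | 0 < birkhoff_max T g n x].
Proof. by apply: measurable_set_ltr => //; exact: measurable_birkhoff_max. Qed.

Lemma birkhoff_max_maximal_inequality n :
  (0 <= \int[mu]_(x in [set x | (0 < birkhoff_max T g n x)%R]) (g x)%:E)%E.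
Proof.
set E := [set x | _].
have mE : measurable E := measurable_birkhoff_max_gt0 n.
have mM := measurable_birkhoff_max n.
have iM := integrable_birkhoff_max n.
have iMT := integrable_measure_preserving hT iM.
have iME := integrableS measurableT mE (@subsetT _ E) iM.
have iMTE := integrableS measurableT mE (@subsetT _ E) iMT.
have igE := integrableS measurableT mE (@subsetT _ E) ig.
apply: (@le_trans _ _ (\int[mu]_(x in E)
  ((EFin \o birkhoff_max T g n) \- ((EFin \o birkhoff_max T g n) \o T)) x)%E);
  last first.
  apply: le_integral => //; first exact: integrableB.
  move=> x; rewrite inE /E /= -EFinB lee_fin.
  case: n {E mE mM iM iMT iME iMTE igE} => [|n]; first by rewrite ltxx.
  (* Since [M_(n+1) x > 0], the maximum is its first argument, so [M_(n+1) x = g x + M_n (T x) <= g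
     x + M_(n+1) (T x)]. *)
  have := birkhoff_max_leS T g n (T x).
  rewrite [birkhoff_max T g n.+1 x]/= lt_max ltxx orbF => le_nS g0.
  by rewrite (max_l (ltW g0)) lerBlDr lerD2l.
rewrite integralB// suber_ge0; last exact: integrable_fin_num.
(* Enlarge the domain of [M_n \o T >= 0] from [E] to [X], remove [T] by invariance of [mu], and
   return to [E], off which [M_n] vanishes. *)
apply: (@le_trans _ _ (\int[mu]_x (birkhoff_max T g n (T x))%:E)%E).
  apply: ge0_subset_integral => //; first exact: (measurable_int mu).
  by move=> x _; rewrite lee_fin birkhoff_max_ge0.
rewrite (@ge0_integral_measure_preserving _ _ _ _ _ hT
  (EFin \o birkhoff_max T g n)).
- rewrite [leRHS]integral_mkcond le_eqVlt; apply/orP; left; apply/eqP.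
  apply: eq_integral => x _; rewrite patchE; case: ifPn => //.
  rewrite notin_setE /E /= => /negP; rewrite -leNgt => M0.
  by congr EFin; apply/le_anti; rewrite M0 birkhoff_max_ge0.
- exact/measurable_EFinP.
- by move=> x; rewrite lee_fin birkhoff_max_ge0.
Qed.

End maximal_inequality.

Lemma lt_maximal_functionP (R : realType) (X : Type) (T : X -> X) (f : X -> R)
    (a : R) (x : X) :
  (a%:E < maximal_function T f x)%E <->
  exists k, k%:R * a < \sum_(0 <= j < k) f (iter j T x).
Proof.
split=> [/ereal_sup_gtP[_ [k /= k1 <-]]|[k ak]].
  rewrite lte_fin /ergodic_average mulrC ltr_pdivlMr ?ltr0n// mulrC => ak.
  by exists k.
have k0 : (0 < k)%N by case: k ak => //; rewrite big_geq// mul0r ltxx.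
apply/ereal_sup_gtP; exists (ergodic_average T f k x)%:E; first by exists k.
by rewrite lte_fin /ergodic_average mulrC ltr_pdivlMr ?ltr0n// mulrC.
Qed.

(** * Truncation where [lambda] is bounded below *)

Section truncation.
Context {R : realType} {d : measure_display} {X : measurableType d}.
Context {mu : probability X R} (T : X -> X).
Hypothesis hT : measure_preserving mu T.
Variables f lambda : X -> R.
Hypothesis hf : mu.-integrable [set: X] (EFin \o f).
Hypothesis mlambda : measurable_fun [set: X] lambda.
Hypothesis hlambda :
  mu.-integrable [set: X] (fun x => (Num.max (lambda x) 0)%:E).

Let mf : measurable_fun [set: X] f.
Proof. exact/measurable_EFinP/(measurable_int mu hf). Qed.

(** Using [k%:R * lambda x] rather than a sum of [lambda] along the orbit makes these sets exhaust
    [{f* > lambda}] at every point, not merely almost everywhere. *)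
Definition trunc_set (n : nat) : set X :=
  [set x | - n%:R <= lambda x] `&`
  \bigcup_(k in [set k | (k <= n)%N])
    [set x | k%:R * lambda x < \sum_(0 <= j < k) f (iter j T x)].

(** The default [0] makes all Birkhoff sums vanish on orbits along which [lambda] is a constant
    below [- n]. *)
Definition trunc_diff (n : nat) (x : X) : R :=
  if - n%:R <= lambda x then f x - lambda x else 0.

Lemma measurable_iter j : measurable_fun [set: X] (iter j T).
Proof.
elim: j => [|j IH]; first exact: measurable_id.
exact: measurableT_comp hT.1 IH.
Qed.

Lemma measurable_lambda_ge (a : R) : measurable [set x | a <= lambda x].
Proof. by rewrite -[X in measurable X]setTI; exact: measurable_fun_le. Qed.

Lemma measurable_trunc_set n : measurable (trunc_set n).
Proof.
apply: measurableI; first exact: measurable_lambda_ge.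
apply: bigcup_measurable => k _.
apply: measurable_set_ltr; first exact: measurable_funM.
by apply: measurable_sum => j; apply: measurableT_comp => //;
  exact: measurable_iter.
Qed.

Lemma nondecreasing_trunc_set : nondecreasing_seq trunc_set.
Proof.
move=> m n mn; apply/subsetPset => x [/= lx [k /= km kx]]; split => /=.
  by apply: le_trans lx; rewrite lerN2 ler_nat.
by exists k => //=; exact: leq_trans mn.
Qed.

Lemma bigcup_trunc_set :
  [set x | ((lambda x)%:E < maximal_function T f x)%E] = \bigcup_n trunc_set n.
Proof.
apply/seteqP; split=> [x /lt_maximal_functionP[k kx]|x [n _ [_ [k _ kx]]]].
  (* The index must dominate both the length [k] and [- lambda x]. *)
  exists (maxn k (Num.truncn `|lambda x|).+1) => //; split => /=; last first.
    by exists k => //=; exact: leq_maxl.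
  have := truncnS_gt `|lambda x|; move: (Num.truncn _).+1 => m lm.
  have : (m%:R : R) <= (maxn k m)%:R by rewrite ler_nat leq_maxr.
  have : - lambda x <= `|lambda x| by rewrite -normrN ler_norm.
  lra.
by apply/lt_maximal_functionP; exists k.
Qed.

Lemma integrable_trunc_diff n :
  mu.-integrable [set: X] (EFin \o trunc_diff n).
Proof.
have ic : mu.-integrable [set: X] (cst n%:R%:E : X -> \bar R).
  exact: finite_measure_integrable_cst.
(* The dominating function is [|f| + (lambda^+ + n)], as [|lambda| <= lambda^+ + n] where
   [lambda >= - n]. *)
have := integrableD measurableT
  (integrable_abse hf) (integrableD measurableT hlambda ic).
apply: le_integrable => //.
  apply/measurable_EFinP; apply: measurable_fun_ifT => //.
    by apply: measurable_fun_ler.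
  exact: measurable_funB.
move=> x _; rewrite /trunc_diff /= lee_fin.
have n0 : 0 <= n%:R :> R := ler0n _ _.
have l0 : 0 <= Num.max (lambda x) 0 by rewrite le_max lexx orbT.
have ll : lambda x <= Num.max (lambda x) 0 by rewrite le_max lexx.
rewrite [leRHS]ger0_norm ?addr_ge0//; case: ifPn => nl; last first.
  by rewrite normr0 !addr_ge0.
rewrite (le_trans (ler_normB _ _))// lerD2l ler_norml; apply/andP; split; lra.
Qed.

Lemma integrable_funeneg_diff :
  mu.-integrable [set: X] (fun x => (f x - lambda x)%:E)^\-%E.
Proof.
have := integrableD measurableT (integrable_abse hf) hlambda.
apply: le_integrable => //.
  by apply: measurable_funeneg; apply/measurable_EFinP; exact: measurable_funB.
move=> x _; rewrite gee0_abs// funenegE.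
have l0 : 0 <= Num.max (lambda x) 0 by rewrite le_max lexx orbT.
have ll : lambda x <= Num.max (lambda x) 0 by rewrite le_max lexx.
have fa : - f x <= `|f x| by rewrite -normrN ler_norm.
rewrite /= -EFin_max lee_fin [leRHS]ger0_norm ?addr_ge0//.
by rewrite ge_max addr_ge0// andbT; lra.
Qed.

Hypothesis lambda_inv : {ae mu, forall x, lambda (T x) = lambda x}.

(** Almost everywhere [lambda] is constant along the whole orbit, so the sums of [trunc_diff] are
    either those of [f] minus [k%:R * lambda x], or all zero. *)
Lemma trunc_set_ae n :
  {ae mu, forall x, trunc_set n x <-> 0 < birkhoff_max T (trunc_diff n) n x}.
Proof.
apply: filterS (ae_measure_preserving_iter hT lambda_inv) => x invx.
have lx j : lambda (iter j T x) = lambda x.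
  by elim: j => //= j <-; exact: invx.
have sumE k : \sum_(0 <= j < k) trunc_diff n (iter j T x) =
    if - n%:R <= lambda x then
      \sum_(0 <= j < k) f (iter j T x) - k%:R * lambda x else 0.
  rewrite /trunc_diff; under eq_bigr do rewrite lx.
  case: ifP => _; last by rewrite big1.
  by rewrite sumrB sumr_const_nat subn0 mulr_natl.
split=> [[/= nl [k /= kn kx]]|/birkhoff_max_gtP[k kn]].
  by apply/birkhoff_max_gtP; exists k => //; rewrite sumE nl subr_gt0.
rewrite sumE; case: ifPn => [nl|_]; last by rewrite ltxx.
by rewrite subr_gt0 => kx; split => //; exists k.
Qed.

Lemma integral_trunc_set_ge0 n :
  (0 <= \int[mu]_(x in trunc_set n) (f x - lambda x)%:E)%E.
Proof.
have ig := integrable_trunc_diff n.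
have mg := measurable_int mu ig.
apply: le_trans (birkhoff_max_maximal_inequality hT ig n) _.
rewrite le_eqVlt; apply/orP; left; apply/eqP.
transitivity (\int[mu]_(x in trunc_set n) (trunc_diff n x)%:E)%E; last first.
  by apply: eq_integral => x; rewrite inE /trunc_diff => -[/= ->].
(* The two domains agree only almost everywhere, so the integrands are extended by zero to [X] and
   compared there. *)
rewrite integral_mkcond [RHS]integral_mkcond; apply: ae_eq_integral => //.
- apply/(measurable_restrictT _ (measurable_birkhoff_max_gt0 hT ig n)).
  exact: measurable_funTS.
- apply/(measurable_restrictT _ (measurable_trunc_set n)).
  exact: measurable_funTS.
- apply: filterS (trunc_set_ae n) => x tx _; rewrite !patchE.
  by congr (if _ then _ else _); apply/idP/idP; rewrite !inE => /tx.
Qed.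

(** This form survives the limit even if the right side tends to [+oo]; the left side is finite, so
    the subtraction can be undone. *)
Lemma integral_trunc_set_funeneg_le n :
  (\int[mu]_(x in trunc_set n) (fun x => (f x - lambda x)%:E)^\- x <=
   \int[mu]_(x in trunc_set n) (fun x => (f x - lambda x)%:E)^\+ x)%E.
Proof.
have := integral_trunc_set_ge0 n; rewrite integralE suber_ge0//.
have mF := measurable_trunc_set n.
exact/integrable_fin_num/(integrableS measurableT mF _ integrable_funeneg_diff).
Qed.

End truncation.

Theorem mainTheorem1 (R : realType) (d : measure_display)
    (X : measurableType d) (mu : probability X R)
    (T : X -> X) (hT : measure_preserving mu T)
    (f : X -> R) (hf : mu.-integrable [set: X] (EFin \o f))
    (lambda : X -> R) (mlambda : measurable_fun [set: X] lambda)
    (lambda_inv : {ae mu, forall x, lambda (T x) = lambda x})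
    (hlambda : mu.-integrable [set: X] (fun x => (Num.max (lambda x) 0)%:E)) :
  (0 <= \int[mu]_(x in [set x | (lambda x)%:E < maximal_function T f x])
          (f x - lambda x)%:E)%E.
Proof.
have mF := measurable_trunc_set hT hf mlambda.
have mU : measurable (\bigcup_n trunc_set T f lambda n).
  exact: bigcup_measurable.
have mg : measurable_fun [set: X] (fun x => (f x - lambda x)%:E).
  apply/measurable_EFinP; apply: measurable_funB => //.
  exact/measurable_EFinP/(measurable_int mu hf).
have nF := @nondecreasing_trunc_set _ _ _ T f lambda.
rewrite bigcup_trunc_set integralE suber_ge0; last first.
  apply/integrable_fin_num => //.
  have := integrable_funeneg_diff hf mlambda hlambda.
  exact: integrableS.
(* The negative parts converge by monotone convergence; the positive parts are simply bounded by
   their integral over the union. *)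
have cvn := ge0_nondecreasing_set_cvg_integral nF mF
  (fun i => measurable_funTS (measurable_funeneg mg))
  (fun _ x _ => funeneg_ge0 _ x).
rewrite -(cvg_lim _ (cvn mu))//; apply: lime_le.
  by apply/cvg_ex; eexists; exact: cvn.
near=> n; apply: le_trans (integral_trunc_set_funeneg_le _ _ _ _ _ _) _ => //.
apply: ge0_subset_integral => //.
  exact/measurable_funTS/measurable_funepos.
by move=> x Fx; exists n.
Unshelve. all: by end_near.
Qed.
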